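(* Let $f:\mathbb{R}^n\to\mathbb{R}$ be continuously differentiable and quasi-convex, and suppose that the solution set of the problem $\min_{x\in\mathbb{R}^n} f(x)$ is nonempty. Let $\{x_k\}$ be an infinite sequence generated by Algorithm TBB (in any of its six variants) applied to this problem, with step sizes satisfying $\sup\{\lambda_k:k=1,2,\dots\}<+\infty$. Then $\{x_k\}$ is a bounded sequence, each accumulation point $x_*$ of $\{x_k\}$ is a stationary point of the problem (i.e. $\nabla f(x_* )=0$), and $\lim_{k\to\infty}x_k=x_*$.
   Context: $f$ is quasi-convex if $f(tx+(1-t)y)\le\max\{f(x),f(y)\}$ for all $x,y\in\mathbb{R}^n$, $t\in[0,1]$. Algorithm TBB (three-point step size gradient method with relaxed generalized Armijo step size rule). Write $g_k=\nabla f(x_k)$. Parameters: $\mu_1,\mu_2\in(0,1)$ with $\mu_1\le\mu_2$; $\gamma_1,\gamma_2>0$; $\sigma_1\in(0,1)$; $\sigma_2\in(1,2)$; $0<\alpha_{\min}<\alpha_{\max}$; $0<\omega<1$. Start from $x_{-1}=x_0\in\mathbb{R}^n$ and $\bar\alpha_0=1$, $k=0$. At iteration $k$: (1) If $g_k=0$, stop; otherwise set $d_k=-\bar\alpha_k g_k$. (2) Choose a number $L_k$ with $0\le L_k\le \bar\alpha_k(-g_k^Td_k)/\|d_k\|^2$. Set $x_{k+1}=x_k+\lambda_kd_k$ with $\lambda_k=\omega^{p_k}$, where $p_k$ is the smallest non-negative integer for which $\lambda_k$ satisfies both (a) $f(x_k+\lambda_kd_k)\le f(x_k)+\mu_1\lambda_k\left(g_k^Td_k+\frac{1}{2\bar\alpha_k}L_k\|d_k\|^2\right)$,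 and (b) $\lambda_k\ge\gamma_1$, or $\lambda_k\ge\gamma_2\lambda_k^*>0$ for some $\lambda_k^*$ with $f(x_k+\lambda_k^*d_k)>f(x_k)+\mu_2\lambda_k^*\left(g_k^Td_k+\frac{1}{2\bar\alpha_k}L_k\|d_k\|^2\right)$. (3) Replace $k$ by $k+1$. With $s_{k-1}=x_k-x_{k-1}$, $s_{k-2}=x_k-x_{k-2}$, $y_{k-1}=g_k-g_{k-1}$, $y_{k-2}=g_k-g_{k-2}$, let $\beta_k=\frac{s_{k-1}^Ty_{k-1}}{\|y_{k-1}\|^2}$ and let $\alpha_k$ be given by one fixed choice among the following six formulas (one per variant): BB1: $\alpha_k=\alpha_k^{BB_1}:=\frac{\|s_{k-1}\|^2}{s_{k-1}^Ty_{k-1}}$; BB2: $\alpha_k=\alpha_k^{BB_2}:=\frac{s_{k-1}^Ty_{k-1}}{\|y_{k-1}\|^2}$; TBB1: $\alpha_k=\frac{\|s_{k-1}\|^2+\|s_{k-2}\|^2}{s_{k-1}^Ty_{k-1}+s_{k-2}^Ty_{k-2}}$; TBB2: $\alpha_k=\frac{s_{k-1}^Ty_{k-1}+s_{k-2}^Ty_{k-2}}{\|y_{k-1}\|^2+\|y_{k-2}\|^2}$; TBB1$'$: $\alpha_k=\lambda\alpha_k^{BB_1}+(1-\lambda)\alpha_k^{BB_2}$ with $\lambda=\left(\frac{\|s_{k-2}\|^2}{y_{k-2}^Ts_{k-2}}-\alpha_k^{BB_2}\right)/(\alpha_k^{BB_1}-\alpha_k^{BB_2})$; TBB2$'$: $\alpha_k=\lambda\alpha_k^{BB_1}+(1-\lambda)\alpha_k^{BB_2}$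 with $\lambda=\left(\frac{y_{k-2}^Ts_{k-2}}{\|y_{k-2}\|^2}-\alpha_k^{BB_2}\right)/(\alpha_k^{BB_1}-\alpha_k^{BB_2})$. Put $\bar\alpha_{\min}=\max\{\alpha_{\min},\sigma_1|\beta_k|\}$ and $\bar\alpha_{\max}=\min\{\alpha_{\max},\sigma_2|\beta_k|\}$. Set $\bar\alpha_k=\alpha_k$ if $\bar\alpha_{\min}\le\alpha_k\le\bar\alpha_{\max}$; $\bar\alpha_k=\bar\alpha_{\min}$ if $\alpha_k<\bar\alpha_{\min}$; $\bar\alpha_k=\bar\alpha_{\max}$ if $\alpha_k>\bar\alpha_{\max}$. Return to (1). Standing assumptions: all quantities above are well defined at every iteration and the algorithm does not stop, so that $\{x_k\}$ is infinite; $\alpha_{\min}\le\beta_k\le\alpha_{\max}$ for all $k\ge1$, and $\alpha_{\min}\le 1\le\alpha_{\max}$. (Consequently $\alpha_{\min}\le\bar\alpha_k\le\alpha_{\max}$ for all $k$.) *)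

(* Defs.v *)
From mathcomp Require Import all_boot all_order all_algebra.
From mathcomp Require Import all_classical all_reals all_analysis.
Set Implicit Arguments.
Unset Strict Implicit.
Unset Printing Implicit Defensive.
Import Order.TTheory GRing.Theory Num.Theory.
Import numFieldNormedType.Exports.
Local Open Scope classical_set_scope.
Local Open Scope ring_scope.

(* The library norm on 'rV[R]_n is the sup norm, which has the same topology and
   bounded sets as the Euclidean one.  Euclidean lengths are always written
   with [dotv] and [sqnorm]. *)
Definition dotv (R : realType) (n : nat) (u v : 'rV[R]_n) : R :=
  \sum_(i < n) u 0 i * v 0 i.

Definition sqnorm (R : realType) (n : nat) (u : 'rV[R]_n) : R := dotv u u.

Definition grad (R : realType) (n : nat) (f : 'rV[R]_n -> R) (x : 'rV[R]_n) :
  'rV[R]_n := \row_(i < n) 'D_(delta_mx 0 i) f x.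

Definition continuously_differentiable (R : realType) (n : nat)
    (f : 'rV[R]_n -> R) : Prop :=
  (forall x, differentiable f x) /\ continuous (grad f).

Definition quasi_convex (R : realType) (n : nat) (f : 'rV[R]_n -> R) : Prop :=
  forall (x y : 'rV[R]_n) (t : R), 0 <= t <= 1 ->
    f (t *: x + (1 - t) *: y) <= Num.max (f x) (f y).

Definition solution_set (R : realType) (n : nat) (f : 'rV[R]_n -> R) :
  set 'rV[R]_n := [set z | forall y, f z <= f y].

Record tbb_params (R : realType) := TBBParams {
  mu1 : R;  mu2 : R;
  gamma1 : R;  gamma2 : R;
  sigma1 : R;  sigma2 : R;
  alpha_min : R;  alpha_max : R;
  omega : R;
  mu1_itv : 0 < mu1 < 1;
  mu2_itv : 0 < mu2 < 1;
  mu1_le_mu2 : mu1 <= mu2;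
  gamma1_gt0 : 0 < gamma1;
  gamma2_gt0 : 0 < gamma2;
  sigma1_itv : 0 < sigma1 < 1;
  sigma2_itv : 1 < sigma2 < 2;
  alpha_min_gt0 : 0 < alpha_min;
  alpha_min_lt_max : alpha_min < alpha_max;
  omega_itv : 0 < omega < 1
}.

Inductive tbb_variant := BB1 | BB2 | TBB1 | TBB2 | TBB1' | TBB2'.

(* [stepsize v s1 y1 s2 y2 a] says that the formula of variant [v], evaluated at
   s_{k-1} = s1, y_{k-1} = y1, s_{k-2} = s2, y_{k-2} = y2, is well defined
   (no denominator vanishes; division by 0 is total here) and has value [a]. *)
Definition stepsize (R : realType) (n : nat) (v : tbb_variant)
    (s1 y1 s2 y2 : 'rV[R]_n) (a : R) : Prop :=
  let bb1 := sqnorm s1 / dotv s1 y1 in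
  let bb2 := dotv s1 y1 / sqnorm y1 in
  let mix theta := theta * bb1 + (1 - theta) * bb2 in
  match v with
  | BB1 => dotv s1 y1 != 0 /\ a = bb1
  | BB2 => sqnorm y1 != 0 /\ a = bb2
  | TBB1 => dotv s1 y1 + dotv s2 y2 != 0 /\
      a = (sqnorm s1 + sqnorm s2) / (dotv s1 y1 + dotv s2 y2)
  | TBB2 => sqnorm y1 + sqnorm y2 != 0 /\
      a = (dotv s1 y1 + dotv s2 y2) / (sqnorm y1 + sqnorm y2)
  | TBB1' =>
      [/\ dotv s1 y1 != 0, sqnorm y1 != 0, dotv y2 s2 != 0, bb1 != bb2 &
          a = mix ((sqnorm s2 / dotv y2 s2 - bb2) / (bb1 - bb2))]
  | TBB2' =>
      [/\ dotv s1 y1 != 0, sqnorm y1 != 0, sqnorm y2 != 0, bb1 != bb2 &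
          a = mix ((dotv y2 s2 / sqnorm y2 - bb2) / (bb1 - bb2))]
  end.

Definition safeguard (R : realType) (lo hi a : R) : R :=
  if lo <= a <= hi then a else if a < lo then lo else hi.

Definition armijo_bound (R : realType) (n : nat) (f : 'rV[R]_n -> R)
    (x d : 'rV[R]_n) (abar L mu lam : R) : R :=
  f x + mu * lam * (dotv (grad f x) d + 1 / (2 * abar) * L * sqnorm d).

Definition armijo_step (R : realType) (n : nat) (P : tbb_params R)
    (f : 'rV[R]_n -> R) (x d : 'rV[R]_n) (abar L lam : R) : Prop :=
  f (x + lam *: d) <= armijo_bound f x d abar L (mu1 P) lam /\
  (gamma1 P <= lam \/
   exists lams : R, [/\ gamma2 P * lams <= lam, 0 < gamma2 P * lams &
     armijo_bound f x d abar L (mu2 P) lams < f (x + lams *: d)]).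

(* s_{k-i} = x_k - x_{k-i} and y_{k-i} = g_k - g_{k-i}, only used with k >= 1 and
   i = 1, 2.  Truncated subtraction makes x (k - i) equal to x_0 for k = 1, i = 2,
   which is the convention x_{-1} = x_0. *)
Definition sdiff (R : realType) (n : nat) (x : nat -> 'rV[R]_n) (k i : nat) :
  'rV[R]_n := x k - x (k - i)%N.

Definition ydiff (R : realType) (n : nat) (f : 'rV[R]_n -> R)
    (x : nat -> 'rV[R]_n) (k i : nat) : 'rV[R]_n :=
  grad f (x k) - grad f (x (k - i)%N).

Definition tbb_beta (R : realType) (n : nat) (f : 'rV[R]_n -> R)
    (x : nat -> 'rV[R]_n) (k : nat) : R :=
  dotv (sdiff x k 1) (ydiff f x k 1) / sqnorm (ydiff f x k 1).

Definition tbb_dir (R : realType) (n : nat) (f : 'rV[R]_n -> R)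
    (x : nat -> 'rV[R]_n) (abar : nat -> R) (k : nat) : 'rV[R]_n :=
  - abar k *: grad f (x k).

(* A non-terminating run of the algorithm: iterates [x], choices [L],
   backtracking exponents [p], step lengths [lam], raw and safeguarded step
   sizes [alpha] and [abar]; [alpha 0] is unused. *)
Record tbb_run (R : realType) (n : nat) (P : tbb_params R) (v : tbb_variant)
    (f : 'rV[R]_n -> R) (x : nat -> 'rV[R]_n) (L : nat -> R) (p : nat -> nat)
    (lam alpha abar : nat -> R) : Prop := TBBRun {
  tbb_abar0 : abar 0%N = 1;
  tbb_nonstop : forall k, grad f (x k) != 0;
  tbb_L : forall k, 0 <= L k <=
    abar k * (- dotv (grad f (x k)) (tbb_dir f x abar k))
      / sqnorm (tbb_dir f x abar k);
  tbb_lam : forall k, lam k = omega P ^+ p k;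
  tbb_armijo : forall k,
    armijo_step P f (x k) (tbb_dir f x abar k) (abar k) (L k) (lam k);
  tbb_smallest : forall k q, (q < p k)%N ->
    ~ armijo_step P f (x k) (tbb_dir f x abar k) (abar k) (L k) (omega P ^+ q);
  tbb_next : forall k, x k.+1 = x k + lam k *: tbb_dir f x abar k;
  tbb_beta_defined : forall k, (0 < k)%N -> sqnorm (ydiff f x k 1) != 0;
  tbb_alpha : forall k, (0 < k)%N ->
    stepsize v (sdiff x k 1) (ydiff f x k 1) (sdiff x k 2) (ydiff f x k 2)
      (alpha k);
  tbb_abar : forall k, (0 < k)%N ->
    abar k = safeguard
      (Num.max (alpha_min P) (sigma1 P * `|tbb_beta f x k|))
      (Num.min (alpha_max P) (sigma2 P * `|tbb_beta f x k|))
      (alpha k)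
}.

(* Main.v *)
Require Import Defs.
From mathcomp Require Import all_boot all_order all_algebra.
From mathcomp Require Import all_classical all_reals all_analysis.
From mathcomp Require Import ring lra.
Import Order.TTheory GRing.Theory Num.Theory.
Import numFieldNormedType.Exports.
Local Open Scope classical_set_scope.
Local Open Scope ring_scope.

(** Write [g k] for the gradient at [x k].  The safeguard keeps [abar k] in
    [alpha_min, alpha_max], and the bound on [L k] amounts to [0 <= L k <= 1], so
    the slope in the Armijo test lies between [- abar k * |g k|^2] and half of it
    ([tbb_slope_itv]).  Hence each step decreases [f] by a fixed multiple of
    [lam k * abar k * |g k|^2] ([tbb_sufficient_decrease]), and as [lam k <= 1]
    this quantity also dominates [|x k.+1 - x k|^2].

    Quasi-convexity makes [- g k] a direction that does not lead away from any
    point [z] with [f z <= f (x k)] ([quasi_convex_grad_le0]).  Expanding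
    [|x k.+1 - z|^2], the only term that can increase the distance to [z] is
    [|x k.+1 - x k|^2], which is paid for by the decrease of [f].  So, for a
    suitable constant [C], the function [|x k - z|^2 + C * f (x k)] is
    nonincreasing in [k] ([tbb_lyapunov_nonincreasing]).

    With [z] a minimizer, this bounds the sequence, which therefore clusters at
    some [xs].  As [f (x k)] decreases, [f xs <= f (x k)] for all [k], so [z := xs]
    is allowed as well: the function of [k] above is nonincreasing and comes
    arbitrarily close to its lower bound [C * f xs], which forces [x k] to converge
    to [xs] ([lyapunov_cvg]).

    If the gradient did not vanish at the limit, [lam k] would tend to 0, because
    [lam k * abar k * |g k|^2] is bounded by a multiple of [f (x k) - f (x k.+1)].
    From some point on [lam k < gamma1], so the trial step [lams] of the relaxed
    Armijo rule exists and also tends to 0.  The mean value theorem turns its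
    failed test into [<grad f y, g k> < mu2 * |g k|^2] for some [y] close to [x k],
    which contradicts [mu2 < 1] in the limit ([tbb_limit_stationary]). *)

(** * Euclidean geometry of row vectors *)

Lemma dotvC {R : realType} {n : nat} (u v : 'rV[R]_n) : dotv u v = dotv v u.
Proof. by apply: eq_bigr => i _; rewrite mulrC. Qed.

Lemma dotvDl {R : realType} {n : nat} (u v w : 'rV[R]_n) :
  dotv (u + v) w = dotv u w + dotv v w.
Proof.
by rewrite /dotv -big_split; apply: eq_bigr => i _; rewrite mxE mulrDl.
Qed.

Lemma dotvZl {R : realType} {n : nat} (a : R) (u v : 'rV[R]_n) :
  dotv (a *: u) v = a * dotv u v.
Proof.
by rewrite /dotv mulr_sumr; apply: eq_bigr => i _; rewrite mxE mulrA.
Qed.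

Lemma dotvDr {R : realType} {n : nat} (u v w : 'rV[R]_n) :
  dotv u (v + w) = dotv u v + dotv u w.
Proof. by rewrite dotvC dotvDl !(dotvC _ u). Qed.

Lemma dotvZr {R : realType} {n : nat} (a : R) (u v : 'rV[R]_n) :
  dotv u (a *: v) = a * dotv u v.
Proof. by rewrite dotvC dotvZl dotvC. Qed.

Lemma dotv0l {R : realType} {n : nat} (u : 'rV[R]_n) : dotv 0 u = 0.
Proof. by rewrite -(scale0r u) dotvZl mul0r. Qed.

Lemma sqnormD {R : realType} {n : nat} (u v : 'rV[R]_n) :
  sqnorm (u + v) = sqnorm u + 2 * dotv u v + sqnorm v.
Proof. by rewrite /sqnorm !dotvDl !dotvDr (dotvC v u); ring. Qed.

Lemma sqnormZ {R : realType} {n : nat} (a : R) (u : 'rV[R]_n) :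
  sqnorm (a *: u) = a ^+ 2 * sqnorm u.
Proof. by rewrite /sqnorm dotvZl dotvZr mulrA. Qed.

Lemma sqnorm_ge0 {R : realType} {n : nat} (u : 'rV[R]_n) : 0 <= sqnorm u.
Proof. by apply: sumr_ge0 => i _; rewrite -expr2 sqr_ge0. Qed.

(** The link between the sup norm, which carries the topology, and Euclidean
    lengths: the largest coordinate contributes one of the squares. *)
Lemma normr_sq_le_sqnorm {R : realType} {n : nat} (u : 'rV[R]_n) :
  `|u| ^+ 2 <= sqnorm u.
Proof.
have [->|u0] := eqVneq u 0; first by rewrite normr0 expr0n sqnorm_ge0.
have /mx_norm_neq0[[i j]] : mx_norm u != 0 by rewrite -[mx_norm u]/`|u| normr_eq0.
rewrite -[mx_norm u]/`|u| /= ord1 => ->.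
rewrite /sqnorm /dotv (bigD1 j)//= real_normK ?num_real// expr2 lerDl.
by apply: sumr_ge0 => k _; rewrite -expr2 sqr_ge0.
Qed.

Lemma sqnorm_gt0 {R : realType} {n : nat} (u : 'rV[R]_n) :
  (0 < sqnorm u) = (u != 0).
Proof.
have [->|u0] := eqVneq u 0.
  by rewrite /sqnorm dotv0l ltxx.
by apply: lt_le_trans (normr_sq_le_sqnorm u); rewrite exprn_gt0 ?normr_gt0.
Qed.

Lemma cvg_dotv {R : realType} {n : nat} {T : Type} {F : set_system T}
    {FF : Filter F} {u v : T -> 'rV[R]_n} {a b : 'rV[R]_n} :
  u @ F --> a -> v @ F --> b -> (fun t => dotv (u t) (v t)) @ F --> dotv a b.
Proof.
move=> ua vb; apply: cvg_big => [|i _]; first exact: add_continuous.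
have coord (w : T -> 'rV[R]_n) (c : 'rV[R]_n) :
    w @ F --> c -> (fun t => w t 0 i) @ F --> c 0 i.
  move=> wc; apply: (cvg_comp w (fun M : 'rV[R]_n => M 0 i) wc).
  exact: coord_continuous.
by apply: cvgM; exact: coord.
Qed.

(** * Gradients *)

Lemma derive_grad {R : realType} {n : nat} (f : 'rV[R]_n -> R)
    (x d : 'rV[R]_n) :
  differentiable f x -> 'D_d f x = dotv (grad f x) d.
Proof.
move=> fx; rewrite deriveE// {1}(row_sum_delta d) linear_sum.
by apply: eq_bigr => i _; rewrite linearZ /= mxE deriveE// mulrC.
Qed.

(** The difference quotient of [f] along the line is, literally, the one that
    defines the derivative of [f] at [x + t *: d] in direction [d]. *)
Lemma is_derive_line {R : realType} {n : nat} (f : 'rV[R]_n -> R)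
    (x d : 'rV[R]_n) (t : R) :
  differentiable f (x + t *: d) ->
  is_derive t 1 (fun s => f (x + s *: d)) (dotv (grad f (x + t *: d)) d).
Proof.
move=> fx.
have E : (fun h : R => h^-1 *: (((fun s => f (x + s *: d)) \o shift t) (h *: 1)
            - f (x + t *: d)))
  = (fun h : R => h^-1 *: ((f \o shift (x + t *: d)) (h *: d)
            - f (x + t *: d))).
  apply/funext => h /=; congr (_ *: (f _ - _)).
  by rewrite -[h *: 1]/(h * 1) mulr1 scalerDl; rewrite addrCA.
have dx := diff_derivable (v := d) fx.
split; first by rewrite /derivable E.
by rewrite -derive_grad// /derive E.
Qed.

Lemma line_mvt {R : realType} {n : nat} (f : 'rV[R]_n -> R)
    (x d : 'rV[R]_n) (t : R) :
  (forall y, differentiable f y) -> 0 < t ->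
  exists2 s, 0 < s < t &
    f (x + t *: d) - f x = t * dotv (grad f (x + s *: d)) d.
Proof.
move=> fd t0.
have fl (s : R) : is_derive s 1 (fun s : R => f (x + s *: d))
    (dotv (grad f (x + s *: d)) d).
  exact/is_derive_line.
have [|s] := MVT t0 (fun s _ => fl s).
  by apply: derivable_within_continuous => s _; case: (fl s).
rewrite in_itv/= => st; rewrite scale0r addr0 subr0 mulrC => E.
by exists s.
Qed.

(** The difference quotients of [f] at [x] towards [y] are nonpositive, since
    [f] stays below [f x] on the segment from [x] to [y]. *)
Lemma quasi_convex_grad_le0 {R : realType} {n : nat} (f : 'rV[R]_n -> R)
    (x y : 'rV[R]_n) :
  quasi_convex f -> differentiable f x -> f y <= f x ->
  dotv (grad f x) (y - x) <= 0.
Proof.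
move=> qc fx fyx; rewrite -derive_grad//.
have dx := diff_derivable (v := y - x) fx.
rewrite /derive cvg_at_rightE//; apply: limr_le.
  by apply/cvg_ex; eexists; apply: cvg_dnbhs_at_right; exact: dx.
near=> h.
have h0 : 0 < h by near: h; exact: nbhs_right_gt.
have h1 : h < 1 by near: h; exact: nbhs_right_lt.
rewrite /= -[_ *: _]/(_ * _) mulr_ge0_le0 ?invr_ge0 ?(ltW h0)// subr_le0.
have -> : h *: (y - x) + x = h *: y + (1 - h) *: x.
  by rewrite scalerBr scalerBl scale1r -addrA [- _ + x]addrC.
apply: le_trans (qc y x h _) _; first by rewrite (ltW h0) (ltW h1).
by rewrite ge_max fyx lexx.
Unshelve. all: by end_near. Qed.

(** * Quasi-Fejer monotone sequences *)

(** Nonincreasing values of this function of [k] express that [x] is quasi-Fejer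
    monotone towards [z]: the increments of [|x k - z|^2] are bounded by those of
    [- C * f (x k)], whose sum telescopes. *)
Definition lyapunov {R : realType} {n : nat} (f : 'rV[R]_n -> R) (C : R)
    (x : nat -> 'rV[R]_n) (z : 'rV[R]_n) (k : nat) : R :=
  sqnorm (x k - z) + C * f (x k).

Lemma lyapunov_bounded {R : realType} {n : nat} (f : 'rV[R]_n -> R) (C m : R)
    (x : nat -> 'rV[R]_n) (z : 'rV[R]_n) :
  0 <= C -> (forall k, m <= f (x k)) ->
  (forall k, lyapunov f C x z k.+1 <= lyapunov f C x z k) -> bounded_fun x.
Proof.
move=> C0 fm /nonincreasing_seqP dec.
set M := lyapunov f C x z 0 - C * m.
have xM k : `|x k - z| ^+ 2 <= M.
  apply: le_trans (normr_sq_le_sqnorm _) _.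
  have := dec 0%N k (leq0n _); have := ler_wpM2l C0 (fm k).
  by rewrite /M /lyapunov; lra.
(* [M >= 0], so [t ^+ 2 <= M] gives [t <= M + 1] without square roots. *)
have xM1 k : `|x k - z| <= M + 1.
  have := xM k; have := normr_ge0 (x k - z); nra.
exists (M + 1 + `|z|); split; first by rewrite num_real.
move=> B BM k _; apply: le_trans (ltW BM).
by rewrite -[x k](subrK z) (le_trans (ler_normD _ _))// lerD2r.
Qed.

Lemma bounded_cluster {R : realType} {n : nat} (x : nat -> 'rV[R]_n) :
  bounded_fun x -> exists xs, cluster (x @ \oo) xs.
Proof.
move=> [M [_ xM]].
have M0 : 0 < `|M| + 1 by rewrite ltr_wpDl.
have cB : compact (closed_ball (0 : 'rV[R]_n) (`|M| + 1)).
  apply: bounded_closed_compact; last exact: closed_ball_closed.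
  exists (`|M| + 1); split; first by rewrite num_real.
  move=> B MB y; rewrite closed_ballE// /closed_ball_/= sub0r normrN => yB.
  exact: le_trans yB (ltW MB).
have [|xs [_ xsx]] := cB (x @ \oo) _; last by exists xs.
exists 0%N => // k _; rewrite /= closed_ballE// /closed_ball_/= sub0r normrN.
by apply: xM => //; rewrite ltr_pwDr// ler_norm.
Qed.

(** The tail of [x] after [k] stays in the sublevel set of [f] at [f (x k)], which
    is closed and hence contains every cluster point. *)
Lemma cluster_nonincreasing_le {R : realType} {n : nat} (f : 'rV[R]_n -> R)
    (x : nat -> 'rV[R]_n) (xs : 'rV[R]_n) :
  continuous f -> (forall k, f (x k.+1) <= f (x k)) ->
  cluster (x @ \oo) xs -> forall k, f xs <= f (x k).
Proof.
move=> fc /(nonincreasing_seqP (f \o x)) dec xsx k.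
rewrite leNgt; apply/negP => lt.
have Fx : (x @ \oo) [set y | f y <= f (x k)] by exists k => // j /= /dec.
have [y [/= yle ygt]] := xsx _ _ Fx (cvgr_gt _ (fc xs) _ lt).
by move: ygt; rewrite ltNge yle.
Qed.

(** At a cluster point, one index [N] where [lyapunov f C x xs] is within [e^2] of
    its lower bound [C * f xs] suffices: monotonicity keeps it there, and then
    [|x k - xs|^2 < e^2] for all later [k]. *)
Lemma lyapunov_cvg {R : realType} {n : nat} (f : 'rV[R]_n -> R) (C : R)
    (x : nat -> 'rV[R]_n) (xs : 'rV[R]_n) :
  continuous f -> 0 <= C -> (forall k, f xs <= f (x k)) ->
  (forall k, lyapunov f C x xs k.+1 <= lyapunov f C x xs k) ->
  cluster (x @ \oo) xs -> x @ \oo --> xs.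
Proof.
move=> fc C0 fxs /nonincreasing_seqP dec xsx.
apply/cvgrPdist_lt => e e0.
pose V y := sqnorm (y - xs) + C * f y.
have Vc : V y @[y --> xs] --> C * f xs.
  have key (T : Type) (F : set_system T) (FF : Filter F) (u : T -> 'rV[R]_n) :
      u @ F --> xs -> V (u t) @[t --> F] --> C * f xs.
    move=> uxs.
    have u0 : u t - xs @[t --> F] --> xs - xs.
      by apply: cvgB => //; exact: cvg_cst.
    have fu : f (u t) @[t --> F] --> f xs by exact: cvg_comp uxs (fc xs).
    have <- : dotv (xs - xs) (xs - xs) + C * f xs = C * f xs.
      by rewrite subrr dotv0l add0r.
    apply: cvgD; first exact: cvg_dotv.
    by apply: cvgM => //; exact: cvg_cst.
  exact: (key _ (nbhs xs) (nbhs_filter xs) id).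
have lt : C * f xs < C * f xs + e ^+ 2 by rewrite ltrDl exprn_gt0.
have FT : (x @ \oo) (range x) by exists 0%N => // k _; exists k.
have [_ [[N _ <-] /= VN]] := xsx _ _ FT (cvgr_lt _ Vc _ lt).
exists N => // k /= Nk; rewrite distrC -(@ltr_pXn2r _ 2) ?nnegrE ?(ltW e0)//.
apply: le_lt_trans (normr_sq_le_sqnorm _) _.
have := dec _ _ Nk; have := ler_wpM2l C0 (fxs k).
by move: VN; rewrite /V /lyapunov; lra.
Qed.

(** * The algorithm *)

Lemma safeguard_itv {R : realType} (lo hi a : R) :
  lo <= hi -> lo <= safeguard lo hi a <= hi.
Proof.
move=> lohi; rewrite /safeguard; case: ifP => // /negbT.
by case: ltP; rewrite lexx lohi.
Qed.

(** Clipping lands between the two safeguards whatever the raw step size, provided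
    that they are in the right order; this follows from [sigma1 < 1 < sigma2] and
    [alpha_min <= beta <= alpha_max]. *)
Lemma tbb_abar_itv {R : realType} {n : nat} {P : tbb_params R} {v : tbb_variant}
    {f : 'rV[R]_n -> R} {x : nat -> 'rV[R]_n} {L : nat -> R} {p : nat -> nat}
    {lam alpha abar : nat -> R} :
  tbb_run P v f x L p lam alpha abar ->
  (forall k, (1 <= k)%N -> alpha_min P <= tbb_beta f x k <= alpha_max P) ->
  alpha_min P <= 1 <= alpha_max P ->
  forall k, alpha_min P <= abar k <= alpha_max P.
Proof.
move=> run beta_bnd one_bnd [|k]; first by rewrite (tbb_abar0 run).
rewrite (tbb_abar run)//; have /andP[b1 b2] := beta_bnd k.+1 isT.
have a0 := alpha_min_gt0 P; have amM := alpha_min_lt_max P.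
have /andP[s10 s11] := sigma1_itv P; have /andP[s21 s22] := sigma2_itv P.
set b := tbb_beta f x k.+1 in b1 b2 *.
rewrite ger0_norm; last exact: le_trans (ltW a0) b1.
have /(fun h => safeguard_itv _ _ (alpha k.+1) h) :
    Num.max (alpha_min P) (sigma1 P * b) <= Num.min (alpha_max P) (sigma2 P * b).
  by rewrite ge_max !le_min; apply/andP; split; apply/andP; split; nra.
by rewrite ge_max le_min => /andP[/andP[-> _] /andP[-> _]].
Qed.

Lemma dotv_tbb_dir {R : realType} {n : nat} (f : 'rV[R]_n -> R)
    (x : nat -> 'rV[R]_n) (abar : nat -> R) (k : nat) :
  dotv (grad f (x k)) (tbb_dir f x abar k) = - abar k * sqnorm (grad f (x k)).
Proof. by rewrite /tbb_dir dotvZr. Qed.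

Lemma sqnorm_tbb_dir {R : realType} {n : nat} (f : 'rV[R]_n -> R)
    (x : nat -> 'rV[R]_n) (abar : nat -> R) (k : nat) :
  sqnorm (tbb_dir f x abar k) = abar k ^+ 2 * sqnorm (grad f (x k)).
Proof. by rewrite /tbb_dir sqnormZ sqrrN. Qed.

(** The upper bound imposed on [L k] is equal to 1, because
    [tbb_dir] is [- abar k] times the gradient.  The correction term thus removes
    between none and half of the slope [- abar k * |grad f (x k)|^2]. *)
Lemma tbb_slope_itv {R : realType} {n : nat} {P : tbb_params R} {v : tbb_variant}
    {f : 'rV[R]_n -> R} {x : nat -> 'rV[R]_n} {L : nat -> R} {p : nat -> nat}
    {lam alpha abar : nat -> R} (k : nat) :
  tbb_run P v f x L p lam alpha abar -> 0 < abar k ->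
  - (abar k * sqnorm (grad f (x k))) <=
    dotv (grad f (x k)) (tbb_dir f x abar k)
      + 1 / (2 * abar k) * L k * sqnorm (tbb_dir f x abar k) <=
  - (abar k * sqnorm (grad f (x k)) / 2).
Proof.
move=> run a0; have := tbb_L run k.
have := tbb_nonstop run k; rewrite -sqnorm_gt0.
rewrite !dotv_tbb_dir sqnorm_tbb_dir; set g := sqnorm _ => g0.
have -> : abar k * - (- abar k * g) / (abar k ^+ 2 * g) = 1.
  by field; rewrite !gt_eqF.
move=> /andP[L0 L1].
have -> : 1 / (2 * abar k) * L k * (abar k ^+ 2 * g) = L k * (abar k * g / 2).
  by field; rewrite gt_eqF.
have ag : 0 < abar k * g by rewrite mulr_gt0.
by apply/andP; split; nra.
Qed.

Lemma tbb_lam_itv {R : realType} {n : nat} {P : tbb_params R} {v : tbb_variant}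
    {f : 'rV[R]_n -> R} {x : nat -> 'rV[R]_n} {L : nat -> R} {p : nat -> nat}
    {lam alpha abar : nat -> R} (k : nat) :
  tbb_run P v f x L p lam alpha abar -> 0 < lam k <= 1.
Proof.
move=> run; have /andP[w0 w1] := omega_itv P.
by rewrite (tbb_lam run) exprn_gt0//= exprn_ile1// ltW.
Qed.

Lemma tbb_sufficient_decrease {R : realType} {n : nat} {P : tbb_params R}
    {v : tbb_variant} {f : 'rV[R]_n -> R} {x : nat -> 'rV[R]_n} {L : nat -> R}
    {p : nat -> nat} {lam alpha abar : nat -> R} (k : nat) :
  tbb_run P v f x L p lam alpha abar -> 0 < abar k ->
  lam k * (abar k * sqnorm (grad f (x k))) <=
    2 / mu1 P * (f (x k) - f (x k.+1)).
Proof.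
move=> run a0; have [+ _] := tbb_armijo run k.
rewrite -(tbb_next run) /armijo_bound.
have /andP[_] := tbb_slope_itv k run a0.
set s := (X in X <= _) => s1; rewrite -/s => dec.
have /andP[m0 _] := mu1_itv P; have /andP[l0 _] := tbb_lam_itv k run.
have ml : 0 < mu1 P * lam k by rewrite mulr_gt0.
rewrite mulrAC ler_pdivlMr//.
by have := ler_wpM2l (ltW ml) s1; lra.
Qed.


(** The choice of [C] makes [|x k.+1 - x k|^2 <= C * (f (x k) - f (x k.+1))]; the
    cross term in [|x k.+1 - z|^2] has the right sign by quasi-convexity. *)
Lemma tbb_lyapunov_nonincreasing {R : realType} {n : nat} {P : tbb_params R}
    {v : tbb_variant} {f : 'rV[R]_n -> R} {x : nat -> 'rV[R]_n} {L : nat -> R}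
    {p : nat -> nat} {lam alpha abar : nat -> R} (z : 'rV[R]_n) (k : nat) :
  tbb_run P v f x L p lam alpha abar ->
  quasi_convex f -> differentiable f (x k) ->
  0 < abar k <= alpha_max P -> f z <= f (x k) ->
  lyapunov f (2 * alpha_max P / mu1 P) x z k.+1
    <= lyapunov f (2 * alpha_max P / mu1 P) x z k.
Proof.
move=> run qc fx /andP[a0 aM] fz.
have gz := quasi_convex_grad_le0 f (x k) z qc fx fz.
have dec := tbb_sufficient_decrease k run a0.
have /andP[l0 l1] := tbb_lam_itv k run.
have g0 : 0 <= sqnorm (grad f (x k)) by exact: sqnorm_ge0.
set C := 2 * alpha_max P / mu1 P.
have step : lam k ^+ 2 * (abar k ^+ 2 * sqnorm (grad f (x k)))
    <= C * (f (x k) - f (x k.+1)).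
  apply: (@le_trans _ _
    (alpha_max P * (lam k * (abar k * sqnorm (grad f (x k)))))).
    have -> : lam k ^+ 2 * (abar k ^+ 2 * sqnorm (grad f (x k))) =
        (lam k * abar k) * (lam k * (abar k * sqnorm (grad f (x k)))) by ring.
    by apply: ler_wpM2r; [rewrite !mulr_ge0// ltW|nra].
  apply: le_trans (ler_wpM2l _ dec) _; first exact: le_trans (ltW a0) aM.
  by rewrite /C le_eqVlt; apply/orP; left; apply/eqP; ring.
have E : x k.+1 - z = (x k - z) + lam k *: tbb_dir f x abar k.
  by rewrite (tbb_next run) addrAC.
rewrite /lyapunov E (sqnormD (x k - z)) sqnormZ sqnorm_tbb_dir.
have -> : dotv (x k - z) (lam k *: tbb_dir f x abar k) =
    lam k * abar k * dotv (grad f (x k)) (z - x k).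
  by rewrite -(opprB z) -scaleN1r dotvZl !dotvZr [dotv (z - _) _]dotvC; ring.
have := mulr_ge0_le0 (mulr_ge0 (ltW l0) (ltW a0)) gz.
by move: step; lra.
Qed.

(** * Stationarity of the limit *)

Lemma tbb_limit_stationary {R : realType} {n : nat} {P : tbb_params R}
    {v : tbb_variant} {f : 'rV[R]_n -> R} {x : nat -> 'rV[R]_n} {L : nat -> R}
    {p : nat -> nat} {lam alpha abar : nat -> R} (xs : 'rV[R]_n) :
  tbb_run P v f x L p lam alpha abar ->
  continuously_differentiable f ->
  (forall k, alpha_min P <= abar k <= alpha_max P) ->
  x @ \oo --> xs -> grad f xs = 0.
Proof.
move=> run [fd gc] abarP xxs; apply/eqP/negPn/negP; rewrite -sqnorm_gt0 => G0.
set G := sqnorm (grad f xs) in G0.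
have aM := alpha_min_gt0 P; have amM := alpha_min_lt_max P.
have /andP[m10 _] := mu1_itv P; have /andP[m20 m21] := mu2_itv P.
have g10 := gamma1_gt0 P; have g20 := gamma2_gt0 P.
have fc : continuous f by move=> y; exact: differentiable_continuous.
have gx : grad f (x k) @[k --> \oo] --> grad f xs by exact: cvg_comp xxs (gc xs).
have fx : f (x k) @[k --> \oo] --> f xs by exact: cvg_comp xxs (fc xs).
have fx1 : f (x k.+1) @[k --> \oo] --> f xs.
  by move: fx; rewrite -(cvg_shiftS (f \o x)).
have sx : sqnorm (grad f (x k)) @[k --> \oo] --> G by exact: cvg_dotv.
have abar0 k : 0 < abar k by have /andP[+ _] := abarP k; exact: lt_le_trans.
have lam0 : lam k @[k --> \oo] --> (0 : R).
  (* Where [|grad f (x k)|^2 > G / 2], sufficient decrease divided by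
     [abar k * |grad f (x k)|^2] leaves at most this factor. *)
  pose K := 2 / mu1 P / (alpha_min P * (G / 2)).
  apply: (@squeeze_cvgr _ _ _ _ (cst 0) (fun k => K * (f (x k) - f (x k.+1)))).
  - have : \forall k \near \oo, G / 2 < sqnorm (grad f (x k)).
      by apply: cvgr_gt sx _ _; lra.
    apply: filterS => k Gk.
    have /andP[l0 _] := tbb_lam_itv k run; rewrite /cst (ltW l0)/=.
    rewrite /K mulrAC ler_pdivlMr; last by nra.
    apply: le_trans (tbb_sufficient_decrease k run (abar0 k)).
    rewrite ler_pM2l//; have /andP[? _] := abarP k.
    by apply: ler_pM => //; lra.
  - exact: cvg_cst.
  - have <- : K * (f xs - f xs) = 0 by rewrite subrr mulr0.
    by apply: cvgM; [exact: cvg_cst|exact: cvgB].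
(* In the limit the failed Armijo test would read [G <= mu2 * G]; joint continuity
   of the gradient rules it out for all pairs of points close to [xs]. *)
pose F := filter_prod (nbhs xs) (nbhs xs).
have [[A B] /= [nA nB] AB] : \forall t \near F,
    0 < dotv (grad f t.1) (grad f t.2) - mu2 P * sqnorm (grad f t.2).
  have g1 : grad f t.1 @[t --> F] --> grad f xs.
    exact: (cvg_comp _ _ (@cvg_fst _ _ (nbhs xs) (nbhs xs) _) (gc xs)).
  have g2 : grad f t.2 @[t --> F] --> grad f xs.
    exact: (cvg_comp _ _ (@cvg_snd _ _ (nbhs xs) (nbhs xs) _) (gc xs)).
  have lim : dotv (grad f t.1) (grad f t.2) - mu2 P * sqnorm (grad f t.2)
      @[t --> F] --> G - mu2 P * G.
    apply: cvgB; first exact: cvg_dotv.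
    by apply: cvgM; [exact: cvg_cst|exact: cvg_dotv].
  by apply: cvgr_gt lim _ _; nra.
have /nbhs_ballP[e /= e0 eA] := nA.
(* [r k] bounds the distance to [xs] of every point of the segment from [x k] to
   the failed trial point, as [lams <= lam k / gamma2]. *)
pose r k := `|xs - x k| + lam k / gamma2 P * alpha_max P * `|grad f (x k)|.
have r0 : r k @[k --> \oo] --> (0 : R).
  have <- : `|xs - xs| + 0 / gamma2 P * alpha_max P * `|grad f xs| = 0.
    by rewrite subrr normr0 !mul0r addr0.
  apply: cvgD; first by apply: cvg_norm; apply: cvgB => //; exact: cvg_cst.
  apply: cvgM; last exact: cvg_norm.
  by apply: cvgM; [apply: cvgM => //; exact: cvg_cst|exact: cvg_cst].
near \oo => k.
have Bk : B (x k) by near: k; exact: xxs nB.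
have rk : r k < e by near: k; exact: cvgr_lt r0 _ e0.
have lk : lam k < gamma1 P by near: k; exact: cvgr_lt lam0 _ g10.
have [_ [|[lams [le_lams gl_gt0]]]] := tbb_armijo run k.
  by rewrite leNgt lk.
have lams0 : 0 < lams by rewrite -(pmulr_rgt0 _ g20).
have [s /andP[s0 s1]] := line_mvt f (x k) (tbb_dir f x abar k) lams fd lams0.
rewrite /armijo_bound => mvt.
have /andP[slope _] := tbb_slope_itv k run (abar0 k).
have /andP[_ akM] := abarP k.
have Ak : A (x k + s *: tbb_dir f x abar k).
  apply: eA; rewrite -ball_normE /ball_ /= opprD addrA.
  apply: le_lt_trans rk; apply: le_trans (ler_normB _ _) _; rewrite lerD2l.
  rewrite /tbb_dir !normrZ normrN (gtr0_norm s0) (gtr0_norm (abar0 k)) mulrA.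
  apply: ler_wpM2r => //; apply: ler_pM; rewrite ?(ltW s0) ?(ltW (abar0 k))//.
  by rewrite ler_pdivlMr// (le_trans _ le_lams)// mulrC ler_pM2l// ltW.
have := AB (_, _) (conj Ak Bk); rewrite /= subr_gt0.
have E : dotv (grad f (x k + s *: tbb_dir f x abar k)) (tbb_dir f x abar k) =
    - abar k * dotv (grad f (x k + s *: tbb_dir f x abar k)) (grad f (x k)).
  by rewrite dotvZr.
move: mvt; rewrite E; set D := dotv (grad f (_ + _)) (grad f _).
set g := sqnorm _ in slope *; set sl := _ + _ * sqnorm _ in slope *.
move=> mvt Dg failed.
have : mu2 P * lams * - (abar k * g) <= mu2 P * lams * sl.
  by apply: ler_wpM2l slope; rewrite mulr_ge0// ltW.
have : 0 < lams * abar k * (D - mu2 P * g) by rewrite !mulr_gt0// subr_gt0.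
by lra.
Unshelve. all: by end_near. Qed.

Theorem lemma3 (R : realType) (n : nat) (f : 'rV[R]_n -> R)
    (f_C1 : continuously_differentiable f)
    (f_qc : quasi_convex f)
    (f_sol : solution_set f !=set0)
    (P : tbb_params R) (v : tbb_variant)
    (x : nat -> 'rV[R]_n) (L : nat -> R) (p : nat -> nat)
    (lam alpha abar : nat -> R)
    (run : tbb_run P v f x L p lam alpha abar)
    (beta_bnd : forall k : nat, (1 <= k)%N ->
       alpha_min P <= tbb_beta f x k <= alpha_max P)
    (one_bnd : alpha_min P <= 1 <= alpha_max P)
    (lam_sup : (ereal_sup [set (lam k)%:E | k in [set k : nat | (1 <= k)%N]]
                < +oo)%E) :
  [/\ bounded_fun x,
      cvg (x @ \oo) &
      forall xs : 'rV[R]_n, cluster (x @ \oo) xs ->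
        grad f xs = 0 /\ x @ \oo --> xs].
Proof.
have abarP := tbb_abar_itv run beta_bnd one_bnd.
have [fd _] := f_C1.
have fc : continuous f by move=> y; exact: differentiable_continuous.
have am0 := alpha_min_gt0 P.
have aM0 : 0 < alpha_max P := lt_trans am0 (alpha_min_lt_max P).
have /andP[m0 _] := mu1_itv P.
have abar0 k : 0 < abar k <= alpha_max P.
  by have /andP[a ->] := abarP k; rewrite (lt_le_trans am0).
pose C := 2 * alpha_max P / mu1 P.
have C0 : 0 <= C by rewrite /C !mulr_ge0 ?invr_ge0// ltW.
have dec k : f (x k.+1) <= f (x k).
  have /andP[a0 _] := abar0 k; have /andP[l0 _] := tbb_lam_itv k run.
  rewrite -subr_ge0 -(@pmulr_rge0 _ (2 / mu1 P)) ?divr_gt0//.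
  apply: le_trans (tbb_sufficient_decrease k run a0).
  by rewrite !mulr_ge0 ?sqnorm_ge0// ltW.
have lyap z : (forall k, f z <= f (x k)) ->
    forall k, lyapunov f C x z k.+1 <= lyapunov f C x z k.
  by move=> fz k; exact: (tbb_lyapunov_nonincreasing z k run).
have [z zmin] := f_sol.
have x_bnd : bounded_fun x.
  apply: (lyapunov_bounded f C (f z) x z C0) => [k|]; first exact: zmin.
  by apply: lyap => k; exact: zmin.
have cluster_cvg xs : cluster (x @ \oo) xs -> x @ \oo --> xs.
  move=> xsx; have fxs := cluster_nonincreasing_le f x xs fc dec xsx.
  exact: (lyapunov_cvg f C x xs fc C0 fxs (lyap _ fxs) xsx).
have [xs0 /cluster_cvg xs0x] := bounded_cluster x x_bnd.
split=> //; first by apply/cvg_ex; exists xs0.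
move=> xs /cluster_cvg xsx; split=> //.
exact: (tbb_limit_stationary xs run f_C1 abarP xsx).
Qed.
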